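(* Let $c>0$ be a constant and let $\mathcal{F}$ be a finite nice family of sets in the plane such that every subfamily $\mathcal{F}'\subseteq\mathcal{F}$ has union complexity at most $c|\mathcal{F}'|$. Then the intersection graph of $\mathcal{F}$ has at most \[ \Big(\big(\tfrac{ce}{2}+1\big)\omega(\mathcal{F})-1\Big)|\mathcal{F}| \] edges, where $e$ is the base of the natural logarithm.
   Context: A family $\mathcal{F}$ of sets in the plane is called nice if every member of $\mathcal{F}$ is a region bounded by a simple closed Jordan curve and these boundary curves are in general position: any two of them cross in only finitely many points (two curves $\alpha,\beta$ cross at a point if $\alpha$ passes from one side of $\beta$ to the other there), no two curves touch or overlap, and no three curves pass through a common point. The union complexity of a family is the number of intersection points of boundaries of two (or more) members of the family that lie on the boundary of the union of all members of the family. The intersection graph of $\mathcal{F}$ has vertex set $\mathcal{F}$, two members being adjacent iff they intersect. $\omega(\mathcal{F})$ denotes the clique number of this intersection graph (the maximum number of pairwise intersecting members). *)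

(* Defs.v *)
From HB Require Import structures.
From mathcomp Require Import all_boot all_order all_algebra.
From mathcomp Require Import all_classical all_reals all_analysis.
From mathcomp Require Import Rstruct Rstruct_topology.
Set Implicit Arguments. Unset Strict Implicit. Unset Printing Implicit Defensive.
Import Order.TTheory GRing.Theory Num.Theory.
Local Open Scope classical_set_scope.
Local Open Scope ring_scope.

Notation RR := Rdefinitions.R.
Notation plane := (RR * RR)%type.

(* A parametrization of a simple closed Jordan curve: a continuous
   1-periodic map R -> R^2 which is injective on [0,1), i.e. a continuous
   injective image of the circle R/Z. *)
Definition jordan_param (g : RR -> plane) : Prop :=
  continuous g /\ (forall t, g (t + 1) = g t) /\
  (forall s t, 0 <= s < 1 -> 0 <= t < 1 -> g s = g t -> s = t).

Definition curve (g : RR -> plane) : set plane := range g.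

Definition bounded_plane (A : set plane) : Prop :=
  exists M : RR, forall p, A p -> `|p.1| <= M /\ `|p.2| <= M.

Definition inside (C : set plane) : set plane :=
  [set p | ~ C p /\ bounded_plane (connected_component (~` C) p)].
Definition outside (C : set plane) : set plane :=
  [set p | ~ C p /\ ~ bounded_plane (connected_component (~` C) p)].

Definition region (g : RR -> plane) : set plane :=
  curve g `|` inside (curve g).

Definition crosses_at (g : RR -> plane) (C : set plane) (p : plane) : Prop :=
  exists t0, g t0 = p /\ exists d : RR, 0 < d /\
    ((forall t, t0 - d < t < t0 -> inside C (g t)) /\
     (forall t, t0 < t < t0 + d -> outside C (g t))
  \/ (forall t, t0 - d < t < t0 -> outside C (g t)) /\
     (forall t, t0 < t < t0 + d -> inside C (g t))).

(* A finite family indexed by the finType I, member i being the region bounded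
   by the Jordan curve gam i, is nice. *)
Definition nice (I : finType) (gam : I -> RR -> plane) : Prop :=
  (forall i, jordan_param (gam i)) /\
  (forall i j, i != j ->
     finite_set (curve (gam i) `&` curve (gam j)) /\
     (forall p, curve (gam i) p -> curve (gam j) p ->
        crosses_at (gam i) (curve (gam j)) p)) /\
  (forall i j k, i != j -> j != k -> i != k ->
     curve (gam i) `&` curve (gam j) `&` curve (gam k) = set0).

Definition boundary (A : set plane) : set plane := closure A `\` interior A.

Definition union_vertices (I : finType) (gam : I -> RR -> plane) (J : {set I})
  : set plane :=
  [set p | (exists i j, [/\ i \in J, j \in J, i != j,
                         curve (gam i) p & curve (gam j) p]) /\
           boundary (\bigcup_(i in [set i | i \in J]) region (gam i)) p].

Definition union_complexity_le (I : finType) (gam : I -> RR -> plane)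
  (J : {set I}) (b : RR) : Prop :=
  forall s : seq plane, uniq s -> (forall p, p \in s -> union_vertices gam J p) ->
    (size s)%:R <= b.

Definition intersect (I : finType) (gam : I -> RR -> plane) (i j : I) : Prop :=
  region (gam i) `&` region (gam j) !=set0.

Definition is_clique (I : finType) (gam : I -> RR -> plane) (K : {set I}) : bool :=
  `[< forall i j, i \in K -> j \in K -> intersect gam i j >].

Definition omega (I : finType) (gam : I -> RR -> plane) : nat :=
  \max_(K : {set I} | is_clique gam K) #|K|.

Definition ig_edges (I : finType) (gam : I -> RR -> plane) : {set {set I}} :=
  [set e : {set I} | (#|e| == 2) && is_clique gam e].

(* Main.v *)
Require Import Defs.
From HB Require Import structures.
From mathcomp Require Import all_boot all_order all_algebra.
From mathcomp Require Import all_classical all_reals all_analysis.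
From mathcomp Require Import Rstruct Rstruct_topology.
From mathcomp Require Import ring lra zify.
Import Order.TTheory GRing.Theory Num.Theory.
Import numFieldNormedType.Exports.
Local Open Scope ring_scope.

(* Let w be the clique number. A crossing point of two boundary curves lies in at
   most w - 2 further regions, because all regions containing it form a clique.
   Hence, if every region is kept independently with probability q = 1/w, the point
   becomes a vertex of the union of the sample with probability at least
   q^2 (1 - q)^(w - 2) >= q^2 / e, while the expected number of union vertices is at
   most c q n; so there are at most c e w n crossing points. Two curves that meet
   cross at least twice, and every point lies on at most two curves, which bounds
   the pairs with meeting boundaries by c e w n / 2. Regions that meet without
   their boundaries meeting are nested, and each region lies in at most w - 1 others.

   That an uncovered crossing point is a boundary point of the union needs one part
   of the Jordan curve theorem: every point of the curve is a limit of outside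
   points. This reduces to the fact that an arc does not separate the plane, which
   follows from the two-dimensional Poincare-Miranda theorem. *)

(** * Random sampling *)

Section RandomSampling.
Context {R : realFieldType} {I : finType}.
Implicit Types (q c : R) (J D E : {set I}).

(* The probability that a random subset containing each index independently
   with probability q equals J. *)
Definition sample_weight q J : R := \prod_i (if i \in J then q else 1 - q).

Lemma sample_weight_ge0 q J : 0 <= q <= 1 -> 0 <= sample_weight q J.
Proof.
by move=> /andP[q0 q1]; apply: prodr_ge0 => i _; case: ifP => // _; rewrite subr_ge0.
Qed.

Lemma sample_hits_avoids q E D : [disjoint E & D] ->
  \sum_(J : {set I} | (E \subset J) && [disjoint D & J]) sample_weight q J =
  q ^+ #|E| * (1 - q) ^+ #|D|.
Proof.
move=> ED.
(* Expanding this product chooses for each index whether it is sampled; the zeroed summands remove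
   exactly the sets that meet [D] or miss part of [E]. *)
transitivity (\prod_i ((if i \in D then 0 else q) + (if i \in E then 0 else 1 - q))).
  rewrite bigA_distr big_mkcond/=; apply: eq_bigr => J _.
  case: ifPn => [/andP[EJ DJ]|].
    apply: eq_bigr => i _; case: ifPn => iJ.
      by case: ifPn => // iD; rewrite (disjointFr DJ iD) in iJ.
    by case: ifPn => // /(fintype.subsetP EJ); rewrite (negPf iJ).
  rewrite negb_and => /orP[/fintype.subsetPn[i iE iJ]|].
    by rewrite (bigD1 i)//= (negPf iJ) iE mul0r.
  rewrite -finset.setI_eq0 => /finset.set0Pn[i]; rewrite inE => /andP[iD iJ].
  by rewrite (bigD1 i)//= iJ iD mul0r.
transitivity (\prod_i ((if i \in E then q else 1) * (if i \in D then 1 - q else 1))).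
  apply: eq_bigr => i _; case: (boolP (i \in E)) => [iE|_].
    by rewrite (disjointFr ED iE) addr0 mulr1.
  by case: ifP => _; rewrite ?add0r ?mul1r// addrC subrK.
by rewrite big_split/= -!big_mkcond/= !prodr_const.
Qed.

Lemma sample_mean_card q : \sum_(J : {set I}) sample_weight q J * #|J|%:R = q * #|I|%:R.
Proof.
transitivity (\sum_(J : {set I}) \sum_(i in J) sample_weight q J).
  by apply: eq_bigr => J _; rewrite sumr_const mulr_natr.
rewrite (exchange_big_dep predT)//=.
rewrite (eq_bigr (fun=> q)) => [|i _]; first by rewrite sumr_const mulr_natr.
rewrite -[RHS](_ : q ^+ #|[set i]| * (1 - q) ^+ #|(finset.set0 : {set I})| = q); last first.
  by rewrite cards1 cards0 expr1 expr0 mulr1.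
rewrite -sample_hits_avoids -?finset.setI_eq0 ?finset.setI0//; apply: eq_bigl => J.
by rewrite finset.sub1set -finset.setI_eq0 finset.set0I eqxx andbT.
Qed.

(* The Clarkson-Shor bound: a configuration x is defined by the two indices in
   def x and killed by those in con x. *)
Lemma clarkson_shor (T : finType) (X : {set T}) (def con : T -> {set I})
    (m : nat) q c : 0 <= q <= 1 ->
    (forall x, x \in X -> [/\ #|def x| = 2, [disjoint def x & con x]
                            & (#|con x| <= m)%N]) ->
    (forall J, #|[set x in X | (def x \subset J) && [disjoint con x & J]]|%:R
               <= c * #|J|%:R) ->
  #|X|%:R * (q ^+ 2 * (1 - q) ^+ m) <= c * (q * #|I|%:R).
Proof.
move=> q01 XP XJ; have /andP[q0 q1] := q01.
rewrite -sample_mean_card mulr_sumr.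
(* The intermediate term is the expected number of configurations that survive in the sample. *)
apply: (@le_trans _ _ (\sum_(J : {set I}) sample_weight q J *
    #|[set x in X | (def x \subset J) && [disjoint con x & J]]|%:R)); last first.
  apply: ler_sum => J _; rewrite mulrCA; apply: ler_wpM2l; last exact: XJ.
  exact: sample_weight_ge0.
rewrite [leRHS](_ : _ = \sum_(x in X)
    \sum_(J : {set I} | (def x \subset J) && [disjoint con x & J]) sample_weight q J); last first.
  rewrite (exchange_big_dep predT)//=; apply: eq_bigr => J _.
  rewrite sumr_const mulr_natr; congr (_ *+ _).
  by apply: eq_card => x; rewrite !inE.
rewrite mulr_natl -sumr_const; apply: ler_sum => x /XP[def2 disj conm].
rewrite sample_hits_avoids// def2 ler_wpM2l ?exprn_ge0//.
by apply: ler_wiXn2l => //; lra.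
Qed.

End RandomSampling.

(** The inverse of [1 - 1/w] is [1 + 1/(w-1)], which is at most [exp(1/(w-1))]; so its power [w-1],
    and a fortiori its power [w-2], is at most e. *)
Lemma expR1_sample_ge1 {R : realType} (w : nat) : (2 <= w)%N ->
  1 <= expR 1 * (1 - w%:R^-1 : R) ^+ w.-2.
Proof.
case: w => [|[|w]]// _ /=; have w0 : (0 : R) < w.+1%:R by rewrite ltr0n.
have -> : 1 - w.+2%:R^-1 = (1 + w.+1%:R^-1)^-1 :> R.
  have w2 : (w.+2%:R : R) = w.+1%:R + 1 by rewrite -addn1 natrD.
  rewrite w2; field; rewrite !gt_eqF//; lra.
rewrite exprVn -ler_pdivrMr ?invr_gt0 ?exprn_gt0// ?mul1r ?invrK.
  apply: (@le_trans _ _ ((1 + w.+1%:R^-1) ^+ w.+1)).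
    by rewrite exprS ler_peMl ?exprn_ge0// ?lerDl ?addr_ge0 ?invr_ge0// ltW.
  apply: (@le_trans _ _ (expR w.+1%:R^-1 ^+ w.+1)).
    by apply: lerXn2r; rewrite ?nnegrE ?expR_ge0 ?expR_ge1Dx ?addr_ge0 ?invr_ge0// ltW.
  by rewrite -expRM_natl mulfV// gt_eqF.
Qed.

Local Open Scope classical_set_scope.
Local Open Scope ring_scope.

(** * The Poincare-Miranda theorem *)

(** A cochain detecting three-coloured cells: it is antisymmetric, so edges shared by neighbouring
    cells cancel in sums. *)
Definition label_jump (x y : option bool) : int :=
  ((x == Some true) && (y == Some false))%:Z
  - ((x == Some false) && (y == Some true))%:Z.

(* The jump is closed around any 4-cycle that misses one of the labels. *)
Lemma label_jump_square (x y z w : option bool) :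
    label_jump x y + label_jump y z - label_jump w z - label_jump x w != 0 ->
  forall l, [\/ l = x, l = y, l = z | l = w].
Proof.
by case: x y z w => [[]|] [[|]|] [[|]|] [[|]|] // _ [[]|];
  (exact: Or41 || exact: Or42 || exact: Or43 || exact: Or44).
Qed.

(* Sperner's lemma for squares: summing the jumps around all cells, a grid
   without a three-coloured cell would have equal jump sums along its bottom and
   its top side, but these are 1 and 0. *)
Lemma grid_three_labels (n : nat) (L : nat -> nat -> option bool) :
    (forall j, (j <= n)%N -> L 0%N j = Some true) ->
    (forall j, (j <= n)%N -> L n j <> Some true) ->
    (forall i, (i <= n)%N -> L i 0%N <> None) ->
    (forall i, (i <= n)%N -> L i n <> Some false) ->
  exists i j, [/\ (i < n)%N, (j < n)%N &
    forall l, exists di dj : bool, L (i + di)%N (j + dj)%N = l].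
Proof.
move=> left_side right_side bottom top; apply: contrapT => none.
pose h i j := label_jump (L i j) (L i.+1 j).
pose v i j := label_jump (L i j) (L i j.+1).
have cell i j : (i < n)%N -> (j < n)%N -> h i j + v i.+1 j - h i j.+1 - v i j = 0.
  move=> lin ljn; apply/eqP; apply: contrapT => /negP/label_jump_square all_l.
  apply: none; exists i, j; split=> // l.
  have [->|->|->|->] := all_l l.
  - by exists false, false; rewrite !addn0.
  - by exists true, false; rewrite addn0 addn1.
  - by exists true, true; rewrite !addn1.
  - by exists false, true; rewrite addn0 addn1.
(* No vertical jumps occur on the left and right sides, so summing the cells of a row leaves only
   its lower and upper edges. *)
have v0 j : (j < n)%N -> v 0%N j = 0.
  by move=> ljn; rewrite /v !left_side// ltnW.
have vn j : (j < n)%N -> v n j = 0.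
  move=> ljn; have := right_side _ ljn; have := right_side _ (ltnW ljn).
  by rewrite /v /label_jump; case: (L n j) => [[]|]; case: (L n j.+1) => [[]|].
have row j : (j < n)%N -> \sum_(0 <= i < n) h i j = \sum_(0 <= i < n) h i j.+1.
  move=> ljn; apply/eqP; rewrite -subr_eq0 -sumrB.
  have -> : \sum_(0 <= i < n) (h i j - h i j.+1) =
            \sum_(0 <= i < n) (v i j - v i.+1 j).
    apply: eq_big_nat => i /= lin; apply/eqP.
    have /eqP := cell i j lin ljn.
    rewrite subr_eq add0r subr_eq => /eqP hv.
    by rewrite subr_eq addrAC -hv addrK.
  rewrite (@telescope_sumr_eq _ 0%N n (fun i => - v i j))//.
    by rewrite v0// vn// oppr0 subrr.
  by move=> i _; rewrite opprK addrC.
have rows j : (j <= n)%N -> \sum_(0 <= i < n) h i 0%N = \sum_(0 <= i < n) h i j.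
  by elim: j => // j IHj ljn; rewrite (IHj (ltnW ljn)) (row _ ljn).
have top0 : \sum_(0 <= i < n) h i n = 0.
  rewrite big_nat big1// => i /= lin.
  have := top _ lin; have := top _ (ltnW lin).
  by rewrite /h /label_jump; case: (L i n) => [[]|]; case: (L i.+1 n) => [[]|].
(* In the absence of [None] a jump is the increment of the indicator of [Some false], which goes
   from 0 to 1 along the bottom. *)
have bottom1 : \sum_(0 <= i < n) h i 0%N = 1.
  rewrite (@telescope_sumr_eq _ 0%N n (fun i => (L i 0%N == Some false)%:Z))//.
    rewrite left_side// subr0; have := right_side 0%N isT.
    by have := bottom n (leqnn n); case: (L n 0%N) => [[]|].
  move=> i /= lin; have := bottom _ lin; have := bottom _ (ltnW lin).
  by rewrite /h /label_jump; case: (L i 0%N) => [[]|]; case: (L i.+1 0%N) => [[]|].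
by move: bottom1; rewrite (rows n)// top0.
Qed.

Section PoincareMiranda.
Context {R : realType}.
Variables (F G : R * R -> R) (a b : R).
Hypotheses (ab : a < b) (cF : continuous F) (cG : continuous G).
Hypotheses (Fa : forall y, a <= y <= b -> F (a, y) < 0)
           (Fb : forall y, a <= y <= b -> 0 <= F (b, y))
           (Ga : forall x, a <= x <= b -> G (x, a) < 0)
           (Gb : forall x, a <= x <= b -> 0 <= G (x, b)).

Let mesh (n : nat) : R := (b - a) / n.+1%:R.
Let node (n i : nat) : R := a + i%:R * mesh n.
Let label (p : R * R) : option bool :=
  if F p < 0 then Some true else if G p < 0 then Some false else None.

Let mesh_gt0 n : 0 < mesh n.
Proof. by rewrite divr_gt0// subr_gt0. Qed.

Let node_last n : node n n.+1 = b.
Proof. by rewrite /node /mesh mulrC divfK ?pnatr_eq0// addrC subrK. Qed.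

Let node_itv n i : (i <= n.+1)%N -> a <= node n i <= b.
Proof.
move=> lin; apply/andP; split; first by rewrite lerDl mulr_ge0// ltW.
by rewrite -(node_last n) lerD2l ler_wpM2r ?ler_nat// ltW.
Qed.

Let small_cell n : exists p, (a <= p.1 <= b /\ a <= p.2 <= b) /\
  forall l, exists q, [/\ label q = l, `|p.1 - q.1| <= mesh n
                       & `|p.2 - q.2| <= mesh n].
Proof.
have [||||i [j [lin ljn all_l]]] :=
    @grid_three_labels n.+1 (fun i j => label (node n i, node n j)).
- by move=> j ljn; rewrite /label /node mul0r addr0 Fa ?node_itv.
- move=> j ljn; rewrite /label node_last ltNge Fb ?node_itv//=.
  by case: ifP.
- move=> i lin; rewrite /label; case: ifP => // _.
  by rewrite {2}/node mul0r addr0 Ga ?node_itv.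
- move=> i lin; rewrite /label; case: ifP => // _.
  by rewrite node_last ltNge Gb ?node_itv.
exists (node n i, node n j); split; first by split; apply: node_itv; exact: ltnW.
move=> l; have [di [dj <-]] := all_l l.
exists (node n (i + di), node n (j + dj)).
have near k (d : bool) : `|node n k - node n (k + d)| <= mesh n.
  rewrite /node opprD addrACA subrr add0r -mulrBl natrD opprD addNKr.
  rewrite normrM normrN normr_nat (gtr0_norm (mesh_gt0 n)).
  by apply: ler_piMl; [exact: ltW|case: d].
by split=> //=; exact: near.
Qed.

(** Three-coloured cells of ever finer grids cluster at a point all of whose neighbourhoods carry
    all three labels. By continuity [Some true] gives [F p <= 0], [Some false] gives [G p <= 0], and
    [None] gives both reverse inequalities. *)
Lemma poincare_miranda : exists p, F p = 0 /\ G p = 0.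
Proof.
have [u uP] := choice small_cell.
have cK : compact (`[a, b] `*` `[a, b] : set (R * R)%type).
  by apply: compact_setX; exact: segment_compact.
have [|p [_ clp]] := cK (u @ \oo)%classic.
  by exists 0%N => // n _; have [[]] := uP n; rewrite /= !in_itv.
have local P : nbhs p P -> forall l, exists2 q, label q = l & P q.
  move=> /nbhs_ballP[e /= e0 peP] l.
  have [N Nmesh] : exists N, forall n, (N <= n)%N -> mesh n < e / 2.
    have e1 : 0 < e / 2 / (b - a) by rewrite !divr_gt0// subr_gt0.
    have [N _ HN] := near_infty_natSinv_lt (PosNum e1).
    exists N => n /HN /=; rewrite /mesh ltr_pdivlMr ?subr_gt0//.
    by rewrite mulrC.
  have [||_ [[n /= Nn <-] pun]] :=
    clp [set u n | n in [set n | (N <= n)%N]] (ball p (e / 2)).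
  - by exists N => // n /= Nn; exists n.
  - by apply: nbhsx_ballx; rewrite divr_gt0.
  have [q [ql q1 q2]] := (uP n).2 l; exists q => //; apply: peP.
  have := Nmesh n Nn.
  case: pun; rewrite /ball/= /ball/= => pu1 pu2 mn.
  split; rewrite /ball/=; [move: pu1 q1|move: pu2 q2];
    rewrite !ltr_norml !ler_norml => /andP[? ?] /andP[? ?]; apply/andP; split; lra.
exists p; split; apply/eqP; rewrite eq_le; apply/andP; split; rewrite leNgt;
  apply/negP => np.
- have [q] := local _ (cvgr_gt _ (cF p) _ np) (Some true).
  by rewrite /label => + Fq; rewrite ltNge (ltW Fq) /=; case: ifP.
- have [q] := local _ (cvgr_lt _ (cF p) _ np) None.
  by rewrite /label => + Fq; rewrite Fq.
- have [q] := local _ (cvgr_gt _ (cG p) _ np) (Some false).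
  by rewrite /label => + Gq; rewrite (ltNge (G q)) (ltW Gq) /=; case: ifP.
- have [q] := local _ (cvgr_lt _ (cG p) _ np) None.
  by rewrite /label => + Gq; rewrite Gq; case: ifP.
Qed.

End PoincareMiranda.

(** * Arcs do not separate the plane *)

Section StarShaped.
Context {R : realType} {V : normedModType R}.
Implicit Types (S U : set V) (x : V).

Lemma star_shaped_connected S x :
  (forall y t, S y -> 0 <= t <= 1 -> S (x + t *: (y - x))) -> connected S.
Proof.
move=> Sstar.
have -> : S = \bigcup_(y in S) ((fun t : R => x + t *: (y - x)) @` `[0, 1]).
  apply/seteqP; split=> [y Sy|_ [y Sy [t /= /[!in_itv]/= t01 <-]]].
    exists y => //; exists 1; first by rewrite /= in_itv/= ler01 lexx.
    by rewrite scale1r addrC subrK.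
  exact: Sstar.
apply: bigcup_connected => [|y _].
  exists x => y _; exists 0; first by rewrite /= in_itv/= ler01 lexx.
  by rewrite scale0r addr0.
apply: connected_continuous_connected; first exact: segment_connected.
apply: continuous_subspaceT => t.
by apply: cvgD; [exact: cvg_cst|apply: cvgZr_tmp; exact: cvg_id].
Qed.

Lemma ball_connected x (r : R) : connected (ball x r).
Proof.
apply: (star_shaped_connected _ x) => y t.
rewrite -ball_normE /= => xyr /andP[t0 t1].
rewrite opprD addNKr normrN normrZ ger0_norm//.
by rewrite distrC (le_lt_trans _ xyr)// ler_piMl.
Qed.

Lemma connected_normedMod : connected [set: V].
Proof. exact: (star_shaped_connected _ 0). Qed.

Lemma open_connected_component U x : open U -> open (connected_component U x).
Proof.
move=> oU; rewrite openE => y Cy.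
have /nbhs_ballP[e /= e0 yeU] : nbhs y U.
  by apply: open_nbhs_nbhs; split=> //; exact: connected_component_sub Cy.
rewrite /interior (same_connected_component Cy).
apply/nbhs_ballP; exists e => //=.
by apply: connected_component_max => //; [exact: ballxx|exact: ball_connected].
Qed.

End StarShaped.

(** * Compactness, connectedness and continuity in the plane *)

Section PlaneGeneric.
Context {R : realType}.
Implicit Types (g : R -> R * R) (K : set (R * R)%type).

Lemma compact_coordinates_bounded K : compact K ->
  exists M : R, forall p, K p -> `|p.1| <= M /\ `|p.2| <= M.
Proof.
move=> cK.
have coord (c : R * R -> R) : continuous c ->
    exists M : R, forall p, K p -> `|c p| <= M.
  move=> cc; have /(@compact_bounded _ R^o)[M [_ cM]] : compact (c @` K).
    by apply: continuous_compact => //; exact: continuous_subspaceT.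
  exists (M + 1) => p Kp; apply: (cM (M + 1)); last by exists p.
  by rewrite ltrDl.
have [|M1 M1P] := coord fst; first by move=> p; exact: cvg_fst.
have [|M2 M2P] := coord snd; first by move=> p; exact: cvg_snd.
exists (Num.max M1 M2) => p Kp.
by rewrite !le_max M1P// M2P// orbT.
Qed.

Lemma ray_connected (p : R * R) :
  connected ((fun t => (p.1 * (1 + t), p.2 * (1 + t))) @` [set t : R | 0 <= t]).
Proof.
apply: connected_continuous_connected.
  by apply/connected_intervalP => x y x0 y0 z /andP[xz _]; exact: le_trans xz.
apply: continuous_subspaceT => t.
have coord (c : R) : (c * (1 + s)) @[s --> t] --> c * (1 + t).
  by apply: cvgM; [exact: cvg_cst|apply: cvgD; [exact: cvg_cst|exact: cvg_id]].
exact: cvg_pair (coord p.1) (coord p.2).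
Qed.

Lemma continuous_image_compact g (a b : R) :
  continuous g -> compact (g @` `[a, b]).
Proof.
by move=> cg; apply: continuous_compact; [exact: continuous_subspaceT|
  exact: segment_compact].
Qed.

Lemma continuous_image_connected g (S : set R) :
  is_interval S -> continuous g -> connected (g @` S).
Proof.
move=> iS cg; apply: connected_continuous_connected; first exact/connected_intervalP.
exact: continuous_subspaceT.
Qed.

Lemma closed_of_compact K : compact K -> closed K.
Proof. by apply: compact_closed; exact: norm_hausdorff. Qed.

Lemma continuous_near g (t : R) (U : set (R * R)%type) :
  continuous g -> nbhs (g t) U ->
  exists2 d : R, 0 < d & forall s, `|s - t| < d -> U (g s).
Proof.
move=> cg /cg/nbhs_ballP[d /= d0 dU]; exists d => // s std.
by apply: dU; rewrite /ball/= distrC.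
Qed.

Lemma shift_continuous g (t : R) : continuous g -> continuous (fun s => g (s + t)).
Proof.
move=> cg s; apply: (@continuous_comp _ _ _ (fun s => s + t) g); last exact: cg.
by apply: cvgD; [exact: cvg_id|exact: cvg_cst].
Qed.

End PlaneGeneric.

Section Arc.
Context {R : realType}.
Implicit Types (g : R -> R * R) (M : R).

Lemma arc_closed g M : continuous g -> closed (g @` `[- M, M]).
Proof.
by move=> cg; apply: closed_of_compact; exact: continuous_image_compact.
Qed.

(* The inverse of an arc is continuous by compactness, hence extends to the
   plane by Tietze's theorem. *)
Lemma arc_retraction g M : 0 < M -> continuous g ->
    {in `[- M, M] &, injective g} ->
  exists r : R * R -> R * R, [/\ continuous r,
    forall p, (g @` `[- M, M]) (r p) & forall p, (g @` `[- M, M]) p -> r p = p].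
Proof.
move=> M0 cg injg; set A := g @` `[- M, M].
(* The inverse parametrization, with default [0] off the arc; only its restriction to the arc is
   extended below. *)
pose h p := xget 0 [set t | - M <= t <= M /\ g t = p].
have hP p : A p -> - M <= h p <= M /\ g (h p) = p.
  move=> [t /= /[!in_itv]/= tM gtp]; rewrite /h.
  by case: xgetP => [_ _ //|/(_ t)]; case.
have ch : {within A, continuous h}.
  apply/subspace_continuousP => p Ap; have [hpM ghp] := hP p Ap.
  apply/(@cvgrPdist_lt _ R^o) => e e0.
  (* The parameters far from [h p] form a compact set; its image is closed and, by injectivity,
     misses [p]. *)
  pose K := `[- M, M]%classic `&` ~` ball (h p) e.
  have cK : compact K.
    apply: compact_closedI; first exact: segment_compact.
    exact/open_closedC/ball_open.
  have clgK : closed (g @` K).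
    apply: closed_of_compact.
    by apply: continuous_compact => //; exact: continuous_subspaceT.
  have : nbhs p (~` (g @` K)).
    apply: open_nbhs_nbhs; split; first exact: closed_openC.
    move=> [t [/= tM tball]] gtp; apply: tball.
    suff -> : t = h p by exact: ballxx.
    by apply: injg; rewrite ?gtp ?ghp// in_itv.
  apply: filterS => q ngKq Aq; have [hqM ghq] := hP q Aq.
  by apply: contrapT => far; apply: ngKq; exists (h q).
(* The extension keeps the bound [M], so [g \o h'] takes values on the arc. *)
have [|h' [hh' ch' h'M]] := continuous_bounded_extension pseudometric_normal
  (arc_closed g M cg) M0 ch.
  by move=> p /hP[hpM _]; rewrite ler_norml.
exists (g \o h'); split.
- by move=> p; apply: continuous_comp; [exact: ch'|exact: cg].
- by move=> p; exists (h' p) => //=; rewrite in_itv/= -ler_norml.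
- by move=> p Ap /=; rewrite -hh' ?inE//; case: (hP p Ap).
Qed.

(* A bounded component could be pushed into the arc by the retraction, giving a
   self-map of the plane that is the identity far away but misses a point. *)
Lemma arc_complement_unbounded g M w : 0 < M -> continuous g ->
    {in `[- M, M] &, injective g} -> ~ (g @` `[- M, M]) w ->
  ~ exists N : R, forall p, connected_component (~` (g @` `[- M, M])) w p ->
      `|p.1| <= N /\ `|p.2| <= N.
Proof.
move=> M0 cg injg Aw [N WN].
have [r [cr rA rid]] := arc_retraction g M M0 cg injg.
have clA := arc_closed g M cg.
move: clA rA rid Aw WN; set A := g @` _ => clA rA rid Aw.
set W := connected_component _ w => WN.
have oA : open (~` A) by exact: closed_openC.
have oW : open W by exact: open_connected_component.
have Ww : W w by exact: connected_component_refl.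
(* The two rules agree on the arc, which contains the frontier of [W]; hence [f] is continuous. *)
pose f p := if pselect (W p) then r p else p.
have fin p : W p -> f p = r p by rewrite /f; case: pselect.
have fout p : ~ W p -> f p = p by rewrite /f; case: pselect.
have cf : continuous f.
  move=> p; have [Wp|Wp] := pselect (W p).
    rewrite /continuous_at fin//.
    apply: cvg_trans (cr p); apply: near_eq_cvg.
    have : nbhs p W by exact: open_nbhs_nbhs.
    by apply: filterS => q Wq; rewrite /= fin.
  rewrite /continuous_at fout//; have [Ap|Ap] := pselect (A p).
    move=> P pP; have rP : nbhs p (r @^-1` P).
      by apply: cr; rewrite rid.
    apply: filterS (filterI pP rP) => q [Pq Prq] /=.
    by rewrite /f; case: pselect.
  apply: cvg_trans cvg_id; apply: near_eq_cvg.
  have cWp : nbhs p (connected_component (~` A) p).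
    apply: open_nbhs_nbhs; split; first exact: open_connected_component.
    exact: connected_component_refl.
  apply: filterS cWp => q pq; apply/esym/fout => Wq; apply: Wp.
  exact: connected_component_trans Wq (connected_component_sym pq).
have [w1 w2] := WN w Ww.
have Nge0 : 0 <= N by exact: le_trans w1.
have bdry x y : N + 1 <= `|x| \/ N + 1 <= `|y| -> f (x, y) = (x, y).
  by move=> xy; apply: fout => /WN/= [xN yN]; case: xy; lra.
have N1 : `|N + 1| = N + 1 by rewrite ger0_norm//; lra.
move: w1 w2; rewrite !ler_norml => /andP[w1 w1'] /andP[w2 w2'].
(* On the boundary of this square [f] is the identity, so [f] attains the value [w]. Yet [f] sends
   [W] into the arc and fixes all points outside [W]. *)
have [|||||||p [p1 p2]] := @poincare_miranda R (fun p => (f p).1 - w.1)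
   (fun p => (f p).2 - w.2) (- (N + 1)) (N + 1).
- by lra.
- by move=> p; apply: cvgB; [apply: cvg_comp (cf p) _; exact: cvg_fst|exact: cvg_cst].
- by move=> p; apply: cvgB; [apply: cvg_comp (cf p) _; exact: cvg_snd|exact: cvg_cst].
- by move=> y _; rewrite bdry/=; [lra|left; rewrite normrN N1].
- by move=> y _; rewrite bdry/=; [lra|left; rewrite N1].
- by move=> y _; rewrite bdry/=; [lra|right; rewrite normrN N1].
- by move=> y _; rewrite bdry/=; [lra|right; rewrite N1].
have fpw : f p = w.
  by rewrite [LHS]surjective_pairing [RHS]surjective_pairing; congr pair; lra.
have [Wp|Wp] := pselect (W p).
  by apply: Aw; rewrite -fpw fin.
by move: (Wp); rewrite -(fout _ Wp) fpw.
Qed.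

End Arc.

(** * Jordan curves *)

Section JordanCurve.
Implicit Types (g : RR -> plane) (C U : set plane) (p q : plane).

Lemma periodic_int g (n : int) t :
  (forall t, g (t + 1) = g t) -> g (t + n%:~R) = g t.
Proof.
move=> per.
have pern (m : nat) s : g (s + m%:R) = g s.
  elim: m => [|m IHm]; first by rewrite addr0.
  by rewrite -addn1 natrD addrA per.
case: n => m; first exact: pern.
by rewrite NegzE mulrNz -[LHS](pern m.+1) subrK.
Qed.

Lemma fractional_part_itv (x : RR) : 0 <= x + (- Num.floor x)%:~R < 1.
Proof.
have := floor_itv x; rewrite intrD mulrNz => /andP[? ?].
by apply/andP; split; lra.
Qed.

(** Reducing both parameters modulo 1 shows that [s - t] is an integer of absolute value below 1.
    The shift moves any chosen point of the curve to parameter 0. *)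
Lemma jordan_shift g (t0 : RR) : jordan_param g -> jordan_param (fun s => g (s + t0)).
Proof.
move=> [cg [per inj]]; split; first exact: (@shift_continuous RR g t0 cg).
split=> [t|s t s01 t01 gst]; first by rewrite addrAC per.
have st := inj _ _ (fractional_part_itv (s + t0)) (fractional_part_itv (t + t0)).
move: st; rewrite !periodic_int// => /(_ gst).
set n := Num.floor (s + t0); set m := Num.floor (t + t0) => st.
have {st} st : s - t = (n - m)%:~R.
  by move: st; rewrite intrB !mulrNz; lra.
have : (-1)%:~R < ((n - m)%:~R : RR) /\ ((n - m)%:~R : RR) < 1%:~R.
  by rewrite -st mulrNz mulr1z; split; lra.
rewrite !ltr_int => -[nm1 nm2]; have nm0 : n - m = 0 by lia.
by move: st; rewrite nm0; lra.
Qed.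

Lemma curve_shift g (t0 : RR) : curve (fun s => g (s + t0)) = curve g.
Proof.
apply/seteqP; split=> [_ [t _ <-]|_ [t _ <-]]; first by exists (t + t0).
by exists (t - t0) => //; rewrite subrK.
Qed.

Lemma curveP g p : jordan_param g -> curve g p -> exists2 t, 0 <= t < 1 & g t = p.
Proof.
move=> [_ [per _]] [t _ <-]; exists (t + (- Num.floor t)%:~R).
  exact: fractional_part_itv.
exact: periodic_int.
Qed.

Lemma curve_compact g : jordan_param g -> compact (curve g).
Proof.
move=> jg; have -> : curve g = g @` `[0, 1].
  apply/seteqP; split=> [p /(curveP _ _ jg)[t /andP[t0 t1] <-]|_ [t _ <-]].
    by exists t => //=; rewrite in_itv/= t0 ltW.
  by exists t.
by apply: (@continuous_image_compact RR g 0 1); case: jg.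
Qed.

Lemma curve_closed g : jordan_param g -> closed (curve g).
Proof. by move=> /curve_compact; exact: (@closed_of_compact RR). Qed.

Lemma curve_bounded g : jordan_param g -> bounded_plane (curve g).
Proof. by move=> /curve_compact; exact: (@compact_coordinates_bounded RR). Qed.

Lemma curve_connected g : jordan_param g -> connected (curve g).
Proof.
by move=> [cg _]; apply: (@continuous_image_connected RR g setT).
Qed.

Lemma inside_or_outside C p : ~ C p -> inside C p \/ outside C p.
Proof.
move=> Cp; have [b|nb] := pselect (bounded_plane (connected_component (~` C) p)).
  by left.
by right.
Qed.

Lemma inside_not_outside C p : inside C p -> ~ outside C p.
Proof. by move=> [_ b] []. Qed.

Lemma connected_inside C (S : set plane) p q : connected S ->
  S `<=` ~` C -> S p -> S q -> inside C p -> inside C q.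
Proof.
move=> cS SC Sp Sq [Cp b]; split; first exact: SC.
rewrite -(@same_connected_component _ _ p)//.
exact: connected_component_max cS _ Sq.
Qed.

Lemma connected_outside C (S : set plane) p q : connected S ->
  S `<=` ~` C -> S p -> S q -> outside C p -> outside C q.
Proof.
move=> cS SC Sp Sq [Cp b]; split; first exact: SC.
rewrite -(@same_connected_component _ _ p)//.
exact: connected_component_max cS _ Sq.
Qed.

(* [RR] carries no normed module structure of its own, but [RR^o] does. *)
Lemma component_nbhs C p : closed C -> ~ C p ->
  nbhs p (connected_component (~` C) p).
Proof.
move=> clC Cp; apply: open_nbhs_nbhs; split; last exact: connected_component_refl.
by apply: (@open_connected_component RR (RR^o * RR^o)%type); exact: closed_openC.
Qed.

Lemma open_inside C : closed C -> open (inside C).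
Proof.
move=> clC; rewrite openE => p ip; have [Cp _] := ip.
apply: filterS (component_nbhs _ _ clC Cp) => q pq.
apply: (connected_inside _ _ p q (@component_connected _ (~` C) p)) => //.
- exact: connected_component_sub.
- exact: connected_component_refl.
Qed.

Lemma open_outside C : closed C -> open (outside C).
Proof.
move=> clC; rewrite openE => p op; have [Cp _] := op.
apply: filterS (component_nbhs _ _ clC Cp) => q pq.
apply: (connected_outside _ _ p q (@component_connected _ (~` C) p)) => //.
- exact: connected_component_sub.
- exact: connected_component_refl.
Qed.

Lemma regionPn g p : ~ region g p <-> outside (curve g) p.
Proof.
split=> [nr|op [/op.1//|ip]]; last exact: inside_not_outside ip op.
have [|//|//] := inside_or_outside (curve g) p.
  by move=> cp; apply: nr; left.
by move=> ip; case: nr; right.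
Qed.

Lemma region_closed g : jordan_param g -> closed (region g).
Proof.
move=> jg; rewrite -openC; have -> : ~` region g = outside (curve g).
  by apply/seteqP; split=> p /regionPn.
exact/open_outside/curve_closed.
Qed.

(** The ray from [p] away from the origin keeps a coordinate beyond [M], so it misses [C] and makes
    the component of [p] unbounded. *)
Lemma far_outside C (M : RR) p : 0 <= M ->
    (forall q, C q -> `|q.1| <= M /\ `|q.2| <= M) ->
    M < `|p.1| \/ M < `|p.2| -> outside C p.
Proof.
move=> M0 CM far.
have rayC : (fun t => (p.1 * (1 + t), p.2 * (1 + t))) @` [set t : RR | 0 <= t]
    `<=` ~` C.
  move=> _ [t /= t0 <-] /CM /=; rewrite !normrM (@ger0_norm _ (1 + t)); last by lra.
  by move=> [? ?]; case: far; nra.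
have rayp : ((fun t => (p.1 * (1 + t), p.2 * (1 + t)))
    @` [set t : RR | 0 <= t]) p.
  by exists 0 => //=; rewrite addr0 !mulr1 -surjective_pairing.
split=> [|[N compN]]; first exact: rayC rayp.
have sub := connected_component_max rayp rayC (@ray_connected RR p).
have NP t : 0 <= t -> `|p.1| * (1 + t) <= N /\ `|p.2| * (1 + t) <= N.
  move=> t0; have := compN (p.1 * (1 + t), p.2 * (1 + t)).
  rewrite /= !normrM (@ger0_norm _ (1 + t)); last by lra.
  by apply; apply: sub; exists t.
have N0 : 0 <= N by have [+ _] := NP 0 (lexx 0); rewrite addr0 mulr1; exact: le_trans.
have contra x : M < x -> (forall t, 0 <= t -> x * (1 + t) <= N) -> False.
  move=> Mx xN; have x0 : 0 < x by lra.
  have := xN (N / x) (divr_ge0 N0 (ltW x0)).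
  by rewrite mulrDr mulrCA divff ?gt_eqF// !mulr1; lra.
by case: far => /contra; apply => t t0; have [] := NP t t0.
Qed.

Lemma region_bounded g : jordan_param g -> bounded_plane (region g).
Proof.
move=> jg; have [M CM] := curve_bounded _ jg.
have M0 : 0 <= M.
  have [+ _] : `|(g 0).1| <= M /\ `|(g 0).2| <= M by apply: CM; exists 0.
  exact: le_trans.
exists M => p rp; split; rewrite leNgt; apply/negP => far;
  move: rp; apply/regionPn; apply: far_outside CM _ => //; by [left|right].
Qed.

End JordanCurve.

(** * Crossings and nesting of Jordan curves *)

Section NiceCurves.
Implicit Types (g h : RR -> plane) (C U : set plane) (p q : plane).

(* If a piece of the curve had no outside points near it, the outside would be
   separated from the inside already by the remaining arc. *)
Lemma outside_near_origin g U : jordan_param g -> inside (curve g) !=set0 ->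
  open U -> U (g 0) -> exists2 p, U p & outside (curve g) p.
Proof.
move=> jg [w iw] oU Ug0; apply: contrapT => Uout.
have clC := curve_closed _ jg; have [cg [per inj]] := jg.
have [|d d0 dU] := @continuous_near RR g 0 U cg; first exact: open_nbhs_nbhs.
(* Parameters within [e] of 0 modulo 1 map into [U]; the cap [1 / 4] leaves a nondegenerate
   remaining arc. *)
pose e := Num.min (d / 2) (1 / 4).
have [e0 ed e4] : [/\ 0 < e, e < d & e <= 1 / 4].
  by rewrite /e; case: (leP (d / 2) (1 / 4)) => ?; split; lra.
pose M := 1 / 2 - e; have M0 : 0 < M by rewrite /M; lra.
(* Recentring opposite [g 0] turns the remaining arc into the image of a symmetric interval. *)
pose k (s : RR) := g (s + 1 / 2).
have ck : continuous k := @shift_continuous RR g (1 / 2) cg.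
have injk : {in `[- M, M] &, injective k}.
  move=> s t; rewrite !in_itv/= /M => /andP[? ?] /andP[? ?] kst.
  suff : s + 1 / 2 = t + 1 / 2 by lra.
  by apply: inj kst; apply/andP; split; lra.
pose A := k @` `[- M, M].
have AC : A `<=` curve g by move=> _ [t _ <-]; exists (t + 1 / 2).
have CA p : curve g p -> A p \/ U p.
  move=> /(curveP _ _ jg)[t /andP[t0 t1] <-].
  have [te|te] := ltP t e.
    by right; apply: dU; rewrite subr0 ger0_norm//; lra.
  have [te'|te'] := ltP (1 - e) t.
    right; have -> : g t = g (t - 1) by rewrite -[in RHS]per subrK.
    by apply: dU; rewrite subr0 ltr_norml; apply/andP; split; lra.
  left; exists (t - 1 / 2); last by rewrite /k subrK.
  by rewrite /= in_itv/= /M; apply/andP; split; lra.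
have clA : closed A := @arc_closed RR k M ck.
(* Closedness of [D] makes the outside relatively closed off the arc, where it is also open. So the
   component of [w] off the arc has no outside points and stays in the bounded region. *)
pose D := outside (curve g) `|` A.
have clD : closed D.
  rewrite -openC; have -> : ~` D = (inside (curve g) `|` U) `&` ~` A.
    apply/seteqP; split=> [p /not_orP[op Ap]|p [iUp Ap] [op|//]].
      split=> //; have [Cp|Cp] := pselect (curve g p).
        by have [//|Up] := CA p Cp; right.
      by have [ip|//] := inside_or_outside _ _ Cp; left.
    case: iUp => [ip|Up]; first exact: inside_not_outside ip op.
    by apply: Uout; exists p.
  apply: openI; last exact: closed_openC.
  by apply: openU => //; exact: open_inside.
have Aw : ~ A w by move=> /AC; case: iw.
pose V := connected_component (~` A) w.
have VA : V `<=` ~` A by exact: connected_component_sub.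
have Vout p : V p -> ~ outside (curve g) p.
  move=> Vp op; apply: (inside_not_outside _ _ iw).
  have VoV : V `&` outside (curve g) = V.
    apply: (@component_connected _ (~` A) w); first by exists p.
      by exists (outside (curve g)) => //; exact: open_outside.
    exists D => //; apply/seteqP; split=> q [Vq]; first by split=> //; left.
    by move=> [oq|/(VA _ Vq)//]; split.
  have [] // : (V `&` outside (curve g)) w.
  by rewrite VoV; exact: connected_component_refl.
apply: (@arc_complement_unbounded RR k M w M0 ck injk Aw).
have [N regN] := region_bounded _ jg; exists N => p Vp; apply: regN.
by apply: contrapT => /regionPn; exact: Vout.
Qed.

Lemma outside_near_curve g U q : jordan_param g -> inside (curve g) !=set0 ->
  curve g q -> open U -> U q -> exists2 p, U p & outside (curve g) p.
Proof.
move=> jg i0 [t _ gtq] oU Uq.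
have := @outside_near_origin (fun s => g (s + t)) U (jordan_shift _ _ jg).
by rewrite curve_shift add0r gtq; apply.
Qed.

Lemma crossing_sides g C p : crosses_at g C p -> exists t0, g t0 = p /\
  exists2 d, 0 < d & forall e, 0 < e < d ->
    inside C (g (t0 - e)) /\ outside C (g (t0 + e)) \/
    outside C (g (t0 - e)) /\ inside C (g (t0 + e)).
Proof.
move=> [t0 [gt0 [d [d0 sides]]]]; exists t0; split=> //; exists d => // e /andP[e0 ed].
by case: sides => -[l r]; [left|right]; split; (apply: l || apply: r);
  apply/andP; split; lra.
Qed.

Lemma crossing_inside g C p : crosses_at g C p -> inside C !=set0.
Proof.
move=> /crossing_sides[t0 [_ [d d0 sides]]].
have [|[i _]|[_ i]] := sides (d / 2); first by apply/andP; split; lra.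
  by exists (g (t0 - d / 2)).
by exists (g (t0 + d / 2)).
Qed.

Lemma crossing_outside_near g C p U : continuous g -> crosses_at g C p ->
  open U -> U p -> exists q, [/\ curve g q, outside C q & U q].
Proof.
move=> cg /crossing_sides[t0 [gt0 [d d0 sides]]] oU Up.
have [|d1 d10 dU] := @continuous_near RR g t0 U cg.
  by apply: open_nbhs_nbhs; rewrite gt0.
pose e := Num.min (d / 2) (d1 / 2).
have [e0 ed ed1] : [/\ 0 < e, e < d & e < d1].
  by rewrite /e; case: (leP (d / 2) (d1 / 2)) => ?; split; lra.
have [|[_ out]|[out _]] := sides e; first by rewrite e0.
  exists (g (t0 + e)); split=> //; [by exists (t0 + e)|apply: dU].
  by rewrite addrAC subrr add0r gtr0_norm.
exists (g (t0 - e)); split=> //; [by exists (t0 - e)|apply: dU].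
by rewrite addrAC subrr add0r normrN gtr0_norm.
Qed.

(* Between two visits of its only crossing point, the curve would have to stay on
   one side. *)
Lemma second_crossing g C p : jordan_param g -> crosses_at g C p ->
  exists q, [/\ curve g q, C q & q <> p].
Proof.
move=> jg /crossing_sides[t0 [gt0 [d d0 sides]]]; apply: contrapT => unique.
have [ck [per inj]] := jordan_shift g t0 jg.
pose k s := g (s + t0); have kE s : k s = g (s + t0) by [].
(* The curve without the crossing point [p]: a connected set that misses [C] if [p] is the only
   common point. *)
pose S := k @` [set s : RR | 0 < s < 1].
have cS : connected S.
  apply: (@continuous_image_connected RR k) ck.
  move=> x y /= /andP[x0 x1] /andP[y0 y1] z /andP[xz zy].
  by apply/andP; split; [exact: lt_le_trans xz|exact: le_lt_trans y1].
have SC : S `<=` ~` C.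
  move=> _ [s /= /andP[s0 s1] <-] Cs; apply: unique; exists (k s); split=> //.
    by exists (s + t0).
  rewrite -gt0 -[t0 in RHS]add0r => ks; suff : s = 0 by lra.
  by apply: inj ks; apply/andP; split; lra.
pose e := Num.min (d / 2) (1 / 2).
have [e0 ed e1] : [/\ 0 < e, e < d & e < 1].
  by rewrite /e; case: (leP (d / 2) (1 / 2)) => ?; split; lra.
have Sr : S (g (t0 + e)).
  by exists e; [rewrite /= e0|rewrite /k addrC].
(* By periodicity the end of the loop is the piece just before [t0]. *)
have Sl : S (g (t0 - e)).
  exists (1 - e); first by rewrite /=; apply/andP; split; lra.
  rewrite -[RHS](jg.2.1) /k; congr g; lra.
have [|[ins out]|[out ins]] := sides e; first by rewrite e0.
  by apply: inside_not_outside out; exact: (connected_inside _ _ _ _ cS SC Sl Sr).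
by apply: inside_not_outside out; exact: (connected_inside _ _ _ _ cS SC Sr Sl).
Qed.

Lemma curve_one_side g C p q : jordan_param g -> curve g `&` C = set0 ->
  curve g p -> curve g q -> inside C p -> inside C q.
Proof.
move=> jg gC gp gq; apply: connected_inside (curve_connected _ jg) _ gp gq.
by apply/disjoints_subset.
Qed.

(** If a point inside [g] were outside [h], its unbounded component off [h] would avoid the curve of
    [g], which lies inside [h], and so fit into a bounded component off [g]. *)
Lemma curve_inside_region g h :
  curve g `<=` inside (curve h) -> region g `<=` region h.
Proof.
move=> gh p [/gh ip|ip]; first by right.
apply: contrapT => /regionPn op; have [_ [N pN]] := ip; have [hp unb] := op.
apply: unb; exists N => q pq; apply: pN.
apply: connected_component_max (@component_connected _ (~` curve h) p) _ pq.
  exact: connected_component_refl.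
move=> r pr gr; apply: inside_not_outside (gh _ gr) _.
apply: (connected_outside _ _ p r (@component_connected _ (~` curve h) p)) => //.
  exact: connected_component_sub.
exact: connected_component_refl.
Qed.

(* Two regions with disjoint boundary curves, each outside the other, meet only if
   their complementary components at a common point coincide; such a component
   has its boundary on both curves, hence is clopen. *)
Lemma disjoint_curves_nested g h : jordan_param g -> jordan_param h ->
    curve g `&` curve h = set0 -> region g `&` region h !=set0 ->
  region g `<=` region h \/ region h `<=` region g.
Proof.
move=> jg jh gh0 [p [rg rh]].
have hg0 : curve h `&` curve g = set0 by rewrite setIC.
have g0 : curve g (g 0) by exists 0.
have h0 : curve h (h 0) by exists 0.
(* A curve disjoint from the other lies on one side of it, so testing one point decides. *)
have [ig|ng] := pselect (inside (curve h) (g 0)).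
  left; apply: curve_inside_region => // q gq.
  exact: (curve_one_side g _ (g 0)) ig.
have [ih|nh] := pselect (inside (curve g) (h 0)).
  right; apply: curve_inside_region => // q hq.
  exact: (curve_one_side h _ (h 0)) ih.
have gout q : curve g q -> ~ region h q.
  move=> gq [hq|iq]; first by move: (conj gq hq); rewrite -[_ /\ _]/((_ `&` _) q) gh0.
  by apply: ng; exact: (curve_one_side g _ q) iq.
have hout q : curve h q -> ~ region g q.
  move=> hq [gq|iq]; first by move: (conj gq hq); rewrite -[_ /\ _]/((_ `&` _) q) gh0.
  by apply: nh; exact: (curve_one_side h _ q) iq.
have ig : inside (curve g) p by case: (rg) => // /gout.
have ih : inside (curve h) p by case: (rh) => // /hout.
pose A := connected_component (~` curve g) p.
pose B := connected_component (~` curve h) p.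
have Ap : A p by apply: connected_component_refl; case: ig.
have sub (k l : RR -> plane) : (forall q, curve k q -> ~ region l q) ->
    inside (curve l) p ->
    connected_component (~` curve l) p `<=` connected_component (~` curve k) p.
  move=> kout il; apply: connected_component_max (@component_connected _ _ _).
    by apply: connected_component_refl; case: il.
  move=> q lq kq; apply: (kout q kq); right.
  apply: (connected_inside _ _ p q (@component_connected _ (~` curve l) p)) => //.
    exact: connected_component_sub.
  by apply: connected_component_refl; case: il.
have AB : A = B by apply/seteqP; split; exact: sub.
have oA : open A.
  apply: (@open_connected_component RR (RR^o * RR^o)%type).
  exact/closed_openC/curve_closed.
have bd (k : RR -> plane) q : jordan_param k -> ~ curve k q ->
    closure (connected_component (~` curve k) p) q ->
    connected_component (~` curve k) p q.
  move=> jk kq /(_ _ (component_nbhs _ _ (curve_closed _ jk) kq))[r [pr qr]].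
  exact: connected_component_trans pr (connected_component_sym qr).
(* A limit point of the common component is off at least one of the two disjoint curves, and
   components are closed relative to the complement. *)
have clA : closed A.
  move=> q clq; have [gq|gq] := pselect (curve g q); last exact: bd.
  rewrite AB; apply: bd => //; last by rewrite -[connected_component _ _]/B -AB.
  by move=> hq; move: (conj gq hq); rewrite -[_ /\ _]/((_ `&` _) q) gh0.
have AT : A = setT.
  apply: (@connected_normedMod RR (RR^o * RR^o)%type); first by exists p.
    by exists A => //; rewrite setTI.
  by exists A => //; rewrite setTI.
by have /connected_component_sub : A (g 0) by rewrite AT.
Qed.

End NiceCurves.

Local Close Scope classical_set_scope.

(** * Nice families *)

Section NiceFamily.
Variables (I : finType) (gam : I -> RR -> plane).
Hypothesis nice_gam : nice gam.
Implicit Types (i j k : I) (J K E : {set I}) (p q : plane).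

Let jordan i : jordan_param (gam i). Proof. by case: nice_gam. Qed.

Let crossing i j p : i != j -> curve (gam i) p -> curve (gam j) p ->
  crosses_at (gam i) (curve (gam j)) p.
Proof. by case: nice_gam => _ [cross _] /cross[_]; apply. Qed.

(** Near [p] curve [i] has points outside [j], and near those there are points outside both. They
    can be kept outside the other regions of [J], which are closed and miss [p]; so [p] is not
    interior to the union. *)
Lemma uncovered_crossing_union_vertex J i j p : i \in J -> j \in J -> i != j ->
    curve (gam i) p -> curve (gam j) p ->
    (forall k, k \in J -> k != i -> k != j -> ~ region (gam k) p) ->
  union_vertices gam J p.
Proof.
move=> iJ jJ ij pi pj uncovered; split; first by exists i, j.
set A := (\bigcup_(k in _) _)%classic.
split; first by apply: subset_closure; exists i => //; left.
move=> pA; pose N k q := k \in J -> k != i -> k != j -> outside (curve (gam k)) q.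
have pN : nbhs p [set q | forall k, N k q]%classic.
  apply: (@filter_forall _ _ N (nbhs p)) => k; case: (boolP [&& k \in J, k != i & k != j]).
    move=> /and3P[kJ ki kj].
    have : nbhs p (outside (curve (gam k))).
      apply: open_nbhs_nbhs; split; first exact/open_outside/curve_closed.
      exact/regionPn/uncovered.
    by apply: filterS => q oq _ _ _.
  by move=> nk; apply: nearW => q kJ ki kj; move: nk; rewrite kJ ki kj.
have oAN : open (interior (A `&` [set q | forall k, N k q])%classic) by exact: open_interior.
have pAN : interior (A `&` [set q | forall k, N k q])%classic p by exact: filterI.
have [q [qi oqj qAN]] := crossing_outside_near _ _ _ _ (jordan i).1
  (crossing _ _ _ ij pi pj) oAN pAN.
have inside_i : (inside (curve (gam i)) !=set0)%classic.
  by apply: crossing_inside; apply: crossing pj pi; rewrite eq_sym.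
have oU : open (interior (A `&` [set q | forall k, N k q]) `&` outside (curve (gam j)))%classic.
  by apply: openI => //; exact/open_outside/curve_closed.
have [r [/interior_subset[[k /= kJ rk] rN] orj] ori] :=
  outside_near_curve _ _ _ (jordan i) inside_i qi oU (conj qAN oqj).
have [ki|ki] := eqVneq k i; first by move: rk; rewrite ki; exact/regionPn.
have [kj|kj] := eqVneq k j; first by move: rk; rewrite kj; exact/regionPn.
by move: rk; apply/regionPn; exact: rN.
Qed.

Let common E p := forall i, i \in E -> curve (gam i) p.

Definition crossing_edges : {set {set I}} :=
  [set E : {set I} | (#|E| == 2) && `[< exists p, common E p >] ].

(** Indexing by [bool] lets pairs of an edge and a boolean enumerate the chosen points. *)
Lemma two_common_points E : E \in crossing_edges ->
  exists f : bool -> plane, (forall b, common E (f b)) /\ f true <> f false.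
Proof.
rewrite inE => /andP[/cards2P[i [j [ij ->]]] /asboolP[p pE]].
have pi : curve (gam i) p by apply: pE; rewrite !inE eqxx.
have pj : curve (gam j) p by apply: pE; rewrite !inE eqxx orbT.
have [q [qi qj qp]] := second_crossing _ _ _ (jordan i) (crossing _ _ _ ij pi pj).
exists (fun b => if b then q else p); split=> // -[] k; last exact: pE.
by rewrite !inE => /orP[/eqP->|/eqP->].
Qed.

(** Distinct pairs sharing a point would put three curves through it. *)
Lemma common_point_edge_unique E E' p :
  #|E| = 2 -> #|E'| = 2 -> common E p -> common E' p -> E = E'.
Proof.
move=> cE cE' pE pE'; apply/eqP; rewrite eqEcard cE cE' leqnn andbT.
apply/fintype.subsetP => k kE; apply: contrapT => /negP kE'.
have /cards2P[i [j [ij E'ij]]] : #|E'| == 2 by rewrite cE'.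
have [iE' jE'] : i \in E' /\ j \in E' by rewrite E'ij !inE !eqxx orbT.
have neq_k l : l \in E' -> l != k by move=> lE'; apply: contraNneq kE' => <-.
have [_ [_ no3]] := nice_gam.
have : (curve (gam i) `&` curve (gam j) `&` curve (gam k))%classic p.
  by split; [split; apply: pE'|exact: pE].
by rewrite no3//; exact: neq_k.
Qed.

Lemma clique_le_omega K : is_clique gam K -> (#|K| <= omega gam)%N.
Proof. by move=> Kc; exact: (@leq_bigmax_cond _ (is_clique gam) (fun K => #|K|)). Qed.

Lemma common_point_clique K p :
  (forall i, i \in K -> region (gam i) p) -> is_clique gam K.
Proof. by move=> pK; apply/asboolP => i j /pK ri /pK rj; exists p. Qed.

Lemma crossing_edges_bound (c : RR) : 0 < c ->
    (forall J, union_complexity_le gam J (c * #|J|%:R)) ->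
  #|crossing_edges|%:R <= c * expR 1 / 2 * (omega gam)%:R * #|I|%:R.
Proof.
move=> c0 cplx.
(* A crossing pair is needed to know that the clique number is at least 2. *)
have [->|[E0 E0c]] := set_0Vmem crossing_edges.
  rewrite cards0; apply: mulr_ge0 => //; apply: mulr_ge0 => //.
  by apply: divr_ge0 => //; apply: mulr_ge0; [exact: ltW|exact: expR_ge0].
have /choice[f fP] : forall E, exists g : bool -> plane, E \in crossing_edges ->
    (forall b, common E (g b)) /\ g true <> g false.
  move=> E; have [/two_common_points[g gE]|nE] := boolP (E \in crossing_edges).
    by exists g.
  by exists (fun=> (0, 0)).
have card2 E : E \in crossing_edges -> #|E| = 2 by rewrite inE => /andP[/eqP].
(* A configuration is one of the two points chosen for a crossing pair; it is killed by the other
   regions covering that point. *)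
pose P (x : {set I} * bool) := f x.1 x.2.
pose X := finset.setX crossing_edges [set: bool].
pose con (x : {set I} * bool) := [set k | (k \notin x.1) && `[< region (gam k) (P x) >] ].
have XE x : x \in X -> x.1 \in crossing_edges by rewrite inE => /andP[].
(* The defining pair and the killing regions share a point, hence form a clique. *)
have omega_ge x : x \in X -> (#|con x| + 2 <= omega gam)%N.
  move=> /XE xc; have [px _] := fP _ xc.
  have -> : (#|con x| + 2 = #|x.1| + #|con x|)%N by rewrite (card2 x.1)// addnC.
  rewrite -cardsUI (_ : x.1 :&: con x = finset.set0); last first.
    by apply/setP => k; rewrite !inE; case: (k \in x.1).
  rewrite cards0 addn0; apply/clique_le_omega/(@common_point_clique _ (P x)) => k.
  rewrite !inE => /orP[kx|/andP[_ /asboolP//]].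
  by left; exact: px.
set w := omega gam in omega_ge *.
have w2 : (2 <= w)%N.
  by apply: leq_trans (omega_ge (E0, true) _); rewrite ?leq_addl// finset.in_setX E0c inE.
have wR : 0 < w%:R :> RR by rewrite ltr0n (leq_trans _ w2).
have q01 : 0 <= (w%:R^-1 : RR) <= 1.
  by rewrite invr_ge0 ltW//= invf_le1// ler1n (leq_trans _ w2).
have cardX : #|X| = (#|crossing_edges| * 2)%N by rewrite cardsX cardsT card_bool.
have bound : #|X|%:R * (w%:R^-1 ^+ 2 * (1 - w%:R^-1) ^+ w.-2)
    <= c * (w%:R^-1 * #|I|%:R).
  apply: (@clarkson_shor RR I _ X fst con) => // [x xX|J].
  - split; first exact/card2/XE.
      rewrite -finset.setI_eq0; apply/eqP/setP => k; rewrite !inE.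
      by case: (k \in x.1).
    by have := omega_ge x xX; lia.
  - set Y := [set x in X | _].
    (* Injectivity turns the surviving configurations into a duplicate-free list of union
       vertices. *)
    have Pinj : {in Y &, injective P}.
      move=> [E b] [E' b']; rewrite inE => /andP[/XE/= Ec _].
      rewrite inE => /andP[/XE/= E'c _] PE.
      have [pE neq] := fP _ Ec; have [pE' _] := fP _ E'c.
      have EE' : E = E'.
        apply: common_point_edge_unique (card2 _ Ec) (card2 _ E'c) (pE b) _.
        by rewrite -[f E b]/(P (E, b)) PE; exact: pE'.
      move: PE; rewrite -EE' /P/=; move: neq.
      by case: b b' => -[] // neq /esym/neq.
    rewrite cardE -(size_map P); apply: cplx.
      rewrite map_inj_in_uniq ?enum_uniq// => x y; rewrite !mem_enum; exact: Pinj.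
    move=> _ /mapP[[E b] + ->]; rewrite mem_enum inE/= => /and3P[/XE/= Ec EJ conJ].
    have [pE _] := fP _ Ec.
    have /cards2P[i [j [ij Eij]]] : #|E| == 2 by rewrite card2.
    have [iE jE] : i \in E /\ j \in E by rewrite Eij !inE !eqxx orbT.
    apply: (@uncovered_crossing_union_vertex _ i j) => //; try exact: pE;
      try exact: (fintype.subsetP EJ).
    move=> k kJ ki kj rk; have /negP := disjointFl conJ kJ.
    have kE : k \notin E by rewrite Eij !inE negb_or ki kj.
    by apply; rewrite inE/= kE; exact/asboolP.
have := @expR1_sample_ge1 RR w w2.
move: bound; rewrite cardX natrM exprVn.
set s := (1 - _) ^+ _; set m := #|crossing_edges|%:R; set n := #|I|%:R => bound s1.
(* Clearing [w^2]; then [1 <= e s] removes the factor [s] at the cost of a factor e. *)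
have {bound} : m * 2 * s <= c * n * w%:R.
  rewrite -(ler_pM2r (x := (w%:R ^+ 2)^-1)) ?invr_gt0 ?exprn_gt0//.
  rewrite -[leLHS]mulrA (mulrC s) (le_trans bound)// le_eqVlt; apply/orP; left.
  by apply/eqP; field; rewrite gt_eqF.
have m0 : 0 <= m by exact: ler0n.
have e0 := expR_gt0 (1 : RR).
move=> bound; nra.
Qed.

(** Each nested pair is charged to its inner region. The regions containing a given one form a
    clique with it, so it is charged at most [omega gam - 1] times; adding [#|I|] on the left avoids
    truncated subtraction. *)
Lemma nested_edges_bound :
  (#|ig_edges gam :\: crossing_edges| + #|I| <= #|I| * omega gam)%N.
Proof.
pose above i :=
  [set j | (j != i) && `[< (region (gam i) `<=` region (gam j))%classic >] ].
have above_omega i : (#|above i| + 1 <= omega gam)%N.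
  have -> : (#|above i| + 1 = #|i |: above i|)%N by rewrite addnC cardsU1 !inE eqxx.
  apply/clique_le_omega/(@common_point_clique _ (gam i 0)) => j.
  have ri : region (gam i) (gam i 0) by left; exists 0.
  by rewrite !inE => /orP[/eqP->//|/andP[_ /asboolP]]; exact.
have sub : ig_edges gam :\: crossing_edges \subset
    \bigcup_i [set [set i; j] | j in above i].
  apply/fintype.subsetP => E; rewrite !inE => /andP[nE /andP[E2 /asboolP clE]].
  move: E2 nE clE => /[dup] E2 /cards2P[i [j [ij Eij]]]; rewrite E2/= => /asboolP nE clE.
  have [iE jE] : i \in E /\ j \in E by rewrite Eij !inE !eqxx orbT.
  have [|sij|sji] := disjoint_curves_nested _ _ (jordan i) (jordan j) _ (clE i j iE jE).
  - apply/seteqP; split=> // p [pi pj]; apply: nE; exists p => k.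
    by rewrite Eij !inE => /orP[/eqP->|/eqP->].
  - apply/bigcupP; exists i => //; rewrite Eij; apply: imset_f.
    by rewrite inE eq_sym ij; exact/asboolP.
  - apply/bigcupP; exists j => //; rewrite Eij finset.setUC; apply: imset_f.
    by rewrite inE ij; exact/asboolP.
have card_sub : (#|ig_edges gam :\: crossing_edges| <= \sum_i #|above i|)%N.
  apply: leq_trans (subset_leq_card sub) _.
  elim/big_rec2: _ => [|i U m _ IH]; first by rewrite cards0.
  rewrite (leq_trans (leq_card_setU _ _))// leq_add//; exact: leq_imset_card.
rewrite -sum_nat_const -[X in (_ + X)%N]muln1.
rewrite -sum_nat_const (leq_trans (leq_add card_sub (leqnn _)))//.
by rewrite -big_split/=; exact: leq_sum.
Qed.

End NiceFamily.

Theorem theorem1 (c : Rdefinitions.R) (I : finType)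
    (gam : I -> Rdefinitions.R -> (Rdefinitions.R * Rdefinitions.R)%type) :
  0 < c ->
  nice gam ->
  (forall J : {set I}, union_complexity_le gam J (c * (#|J|)%:R)) ->
  (#|ig_edges gam|)%:R <=
    ((c * expR 1 / 2 + 1) * (omega gam)%:R - 1) * (#|I|)%:R.
Proof.
move=> c0 ng cplx.
have cross := crossing_edges_bound _ _ ng _ c0 cplx.
have nested := nested_edges_bound _ _ ng.
(* Edges are split according to whether the two boundary curves meet. *)
have : #|ig_edges gam|%:R <= #|crossing_edges I gam|%:R
    + #|ig_edges gam :\: crossing_edges I gam|%:R :> RR.
  rewrite -natrD ler_nat -(cardsID (crossing_edges I gam)) leq_add2r.
  by rewrite subset_leq_card// finset.subsetIr.
move: cross nested; rewrite -(ler_nat RR) natrD natrM.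
move: (expR 1) #|_|%:R #|_|%:R #|_|%:R #|_|%:R (omega _)%:R => e x y z t u.
by rewrite mulrBl mul1r !mulrDl mul1r; lra.
Qed.
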